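(* Let $G^{\nu}$ be a wconnected transfinite wgraph of rank $\nu$, $0\le\nu\le\omega$ (possibly $\nu=\vec{\omega}$). If $\alpha<\rho\le\nu$ are ranks and $S^{\alpha}$ is an $\alpha$-wsection of $G^\nu$ lying in a $\rho$-wsection $S^{\rho}$ of $G^\nu$, then the enlargement ${}^{*}\!S^{\alpha}$ of $S^{\alpha}$ lies within the principal $\rho$-galaxy $\Gamma_0^{\rho}(S^{\rho})$ of ${}^{*}\!S^{\rho}$; that is, every hypernode in ${}^{*}\!S^{\alpha}$ is a hypernode in $\Gamma_0^{\rho}(S^{\rho})$, and consequently every hyperbranch in ${}^{*}\!S^{\alpha}$ is a hyperbranch in $\Gamma_0^{\rho}(S^{\rho})$.
   Context: **Ranks.** Ranks are ordered $0<1<2<\cdots<\vec{\omega}<\omega$ ($\vec{\omega}$ is a special rank preceding $\omega$; $\omega-1$ means $\vec{\omega}$). Sums of ordinals are natural (Hessenberg) sums, ordinals being in normal form. **Wgraphs.** A $0$-wgraph is a graph $\{X^0,B\}$ with $X^0$ a set of $0$-nodes (also called $0$-wnodes) and $B$ a set of branches (two-element subsets of $X^0$). A (nontrivial) $0$-walk is an alternating sequence $\langle\dots,x_m,b_m,x_{m+1},b_{m+1},\dots\rangle$ of $0$-nodes and branches with $b_m=\{x_m,x_{m+1}\}$, having at least one branch; it is two-ended (finite, ending at $0$-nodes), one-ended, or endless; repetitions are allowed. For each rank $\alpha$, two one-ended $\alpha$-walks are equivalent if they are eventually identical (up to a shift of indices); the equivalence classes are the $\alpha$-wtips, whose members are called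 representatives. For $\mu\in\{1,2,\dots\}\cup\{\omega\}$, given a $(\mu-1)$-wgraph, partition its set of $(\mu-1)$-wtips into nonempty subsets $T_\tau$; for each $\tau$ let $X_\tau$ be empty or a singleton containing an $\alpha$-wnode with $\alpha<\mu$, where no wnode is such an exceptional element of two different wnodes; each $x^\mu_\tau=T_\tau\cup X_\tau$ is a $\mu$-wnode. A wnode embraces itself, its elements, and everything embraced by its exceptional element. $X^\mu$ is the set of $\mu$-wnodes and $\{X^0,B,X^1,\dots,X^\mu\}$ is a $\mu$-wgraph. An $\vec{\omega}$-wgraph has wnode sets $X^\mu$ for all natural $\mu$, and a (possibly empty) set $X^{\vec{\omega}}$ of $\vec{\omega}$-wnodes, i.e. infinite sequences of wnodes of strictly increasing natural ranks, each embracing its predecessor. All $X^\rho$ are nonempty for $\rho\neq\vec{\omega}$. **Walks.** A walk reaches a wnode $x$ at one of its ends if its terminal wnode there is embraced by $x$, or if it is infinite there and the corresponding wtip is embraced by $x$. For $\mu\in\{1,2,\dots\}\cup\{\omega\}$ a $\mu$-walk is an alternating sequence $\langle\dots,x_m,W_m,x_{m+1},W_{m+1},\dots\rangle$ in which interior $x_m$ are $\mu$-wnodes, terminal $x_m$ (if any) are wnodes of rank $\le\mu$, each $W_m$ is a nontrivial walk of rank $\alpha_m<\mu$ reaching $x_m$ and $x_{m+1}$ at its two ends, and for each interior $x_m$ at least one of $W_{m-1},W_m$ reaches $x_m$ through a $(\mu-1)$-wtip. A one-ended $\vec{\omega}$-walk is $\langle x_0,W_0,x_1,W_1,\dots\rangle$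 where the $x_m$ are wnodes of strictly increasing natural ranks $\mu_m$ and $W_m$ is a $(\mu_{m+1}-1)$-walk reaching $x_m$ and reaching $x_{m+1}$ through a $(\mu_{m+1}-1)$-wtip; an endless one is two of these joined at the start; there are no two-ended $\vec{\omega}$-walks. **Lengths and wdistances.** A two-ended $0$-walk has length its number of branch traversals; for natural $\mu$ a one-ended (endless) $\mu$-walk has length $\omega^{\mu+1}$ ($\omega^{\mu+1}\cdot 2$); a one-ended (endless) $\vec{\omega}$-walk has length $\omega^{\omega}$ ($\omega^\omega\cdot 2$); a one-ended (endless) $\omega$-walk has length $\omega^{\omega+1}$ ($\omega^{\omega+1}\cdot2$); a two-ended $\mu$-walk with $\mu\ge1$ has as length the natural sum of the lengths of its $W_m$. The wdistance $d(x,y)$ is the minimum of the lengths of the two-ended walks terminating at $x$ and $y$ (wnodes embraced one by the other are not distinguished), with $d(x,x)=0$. A wgraph is wconnected if any two of its wnodes are joined by a two-ended walk. **Wsections.** A wsubgraph induced by a set $B_s\subset B$ consists of $B_s$, the $0$-nodes incident to it, and the $\gamma$-wnodes embracing a $(\gamma-1)$-wtip with a representative whose branches all lie in $B_s$. A $\rho$-wsection $S^\rho$ of $G^\nu$ is a maximal wsubgraph of $\{X^0,B,\dots,X^\rho\}$ that is $\rho$-wconnected, i.e. any two of its wnodes are the terminal wnodes of a two-ended $\alpha$-walk with $\alpha\le\rho$ ($\alpha<\vec{\omega}$ when $\rho=\vec{\omega}$). The only $\nu$-wsection is $G^\nu$. $S^\rho$ is regarded as a $\rho$-wgraph by itself,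 with its own wdistance $d$. $S^\alpha$ lies in $S^\rho$ if its branches all belong to $S^\rho$. **Enlargement.** Fix a free ultrafilter $\mathcal F$ on $\mathbb N$. For a wgraph $S$, a $\gamma$-hypernode $\mathbf x=[x_n]$ of the enlargement ${}^{*}\!S$ is an equivalence class of sequences of $\gamma$-wnodes of $S$ under equality for all $n$ in a member of $\mathcal F$; hyperbranches are the analogous classes $[b_n]$ of sequences of branches, $[\{x_n,y_n\}]$ being incident to the $0$-hypernodes $[x_n],[y_n]$. A standard hypernode is the class of a constant sequence. ${}^{*}\!S$ consists of all hypernodes and hyperbranches. **Galaxies.** For $\rho$ natural or $\rho=\omega$, hypernodes $[x_n],[y_n]$ (of any ranks) of ${}^{*}\!S^\rho$ are $\rho$-limitedly distant if there is $\mu\in\mathbb N$ with $\{n: d(x_n,y_n)\le\omega^\rho\cdot\mu\}\in\mathcal F$; for $\rho=\vec{\omega}$ they are $\vec{\omega}$-limitedly distant if there is $\mu\in\mathbb N$ with $\{n: d(x_n,y_n)\le\omega^{\mu}\}\in\mathcal F$. This is an equivalence relation; its classes are the nodal $\rho$-galaxies, and a $\rho$-galaxy is a nodal $\rho$-galaxy together with all hyperbranches whose incident $0$-hypernodes lie in it. The principal $\rho$-galaxy $\Gamma_0^\rho(S^\rho)$ of ${}^{*}\!S^\rho$ is the one whose hypernodes are $\rho$-limitedly distant from a standard hypernode of ${}^{*}\!S^\rho$. *)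

(* Defs.v *)
From HB Require Import structures.
From mathcomp Require Import all_boot all_order all_algebra.
From mathcomp Require Import boolp classical_sets filter.
Set Implicit Arguments.
Unset Strict Implicit.
Unset Printing Implicit Defensive.
Import Order.TTheory GRing.Theory Num.Theory.
Local Open Scope classical_set_scope.

(* Arrow is the special rank between the natural ranks and omega. *)
Inductive rank : Type := Fin of nat | Arrow | Omega.

Definition rank_le (r s : rank) : bool :=
  match r, s with
  | Fin m, Fin n => (m <= n)%N
  | Fin _, _ => true
  | Arrow, Fin _ => false
  | Arrow, _ => true
  | Omega, Omega => true
  | Omega, _ => false
  end.

Definition rank_lt (r s : rank) : bool := rank_le r s && ~~ rank_le s r.

(* mu - 1, for mu in {1, 2, ...} or mu = omega *)
Definition rank_pred (r : rank) : option rank :=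
  match r with
  | Fin n.+1 => Some (Fin n)
  | Omega => Some Arrow
  | _ => None
  end.

(* Ordinals below omega ^ (omega ^ 2), in Cantor normal form: the finite
   non-increasing sequence e_1 >= ... >= e_k of exponents stands for
   omega ^ e_1 + ... + omega ^ e_k, and the exponent (a, b) for omega * a + b.
   The order of these ordinals is the lexicographic one (a proper prefix being
   smaller), and their natural (Hessenberg) sum merges the exponents. *)
Definition expo : orderType _ := (nat *l nat)%type.

Record cnf : Type :=
  Cnf { cnf_seq : seq expo; cnf_sorted : sorted (>=%O : rel expo) cnf_seq }.

Definition cnf_le (a b : cnf) : bool :=
  ((cnf_seq a : seqlexi expo) <= cnf_seq b)%O.

Lemma sorted_nseq_expo (k : nat) (e : expo) :
  sorted (>=%O : rel expo) (nseq k e).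
Proof. by case: k => //= k; elim: k => //= k ->; rewrite lexx. Qed.

(* omega ^ e * k *)
Definition omega_pow (e : expo) (k : nat) : cnf := Cnf (sorted_nseq_expo k e).

Definition cnf_nat (k : nat) : cnf := omega_pow (0, 0)%N k.

Definition cnf_add (a b : cnf) : cnf :=
  Cnf (merge_sorted (fun x y : expo => le_total y x)
         (cnf_sorted a) (cnf_sorted b)).

(* A walk is a sequence <..., x_m, w_m, x_(m+1), w_(m+1), ...> indexed by an
   interval of the integers, the entries outside of this interval being None;
   w_m is traversed from x_m to x_(m+1). The links w_m are branches (sets of
   nodes) in a 0-walk, and walks in a walk of positive rank. *)
Inductive walk (V : Type) : Type :=
  | Walk0 of (int -> option V) & (int -> option (set V))
  | WalkS of rank & (int -> option V) & (int -> option (walk V)).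

Section Walks.
Variable V : Type.
Implicit Types (w : walk V).

Definition wrank w : rank :=
  match w with Walk0 _ _ => Fin 0 | WalkS r _ _ => r end.

Definition wnode_at w : int -> option V :=
  match w with Walk0 x _ => x | WalkS _ x _ => x end.

Fixpoint wbranches w : set (set V) :=
  match w with
  | Walk0 _ l => [set b | exists m, l m = Some b]
  | WalkS _ _ l =>
      [set b | exists m, if l m is Some u then wbranches u b else False]
  end.

Fixpoint wrev w : walk V :=
  match w with
  | Walk0 x l => Walk0 (fun m => x (- m)%R) (fun m => l (- m - 1)%R)
  | WalkS r x l =>
      WalkS r (fun m => x (- m)%R) (fun m => omap wrev (l (- m - 1)%R))
  end.

Definition alternating L (x : int -> option V) (l : int -> option L) : Prop :=
  [/\ exists m, l m <> None,
      forall m n k : int, (m <= n <= k)%R ->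
        l m <> None -> l k <> None -> l n <> None
    & forall m, x m <> None <-> l (m - 1)%R <> None \/ l m <> None].

Definition left_end w (p : int) (v : V) : Prop :=
  wnode_at w p = Some v /\ wnode_at w (p - 1)%R = None.
Definition right_end w (p : int) (v : V) : Prop :=
  wnode_at w p = Some v /\ wnode_at w (p + 1)%R = None.

Definition left_ended w : Prop := exists p v, left_end w p v.
Definition right_ended w : Prop := exists p v, right_end w p v.

Definition two_ended w : Prop := left_ended w /\ right_ended w.
Definition endless w : Prop := ~ left_ended w /\ ~ right_ended w.
Definition one_ended_right w : Prop := left_ended w /\ ~ right_ended w.
Definition one_ended_left w : Prop := ~ left_ended w /\ right_ended w.

Definition opt_rel A (E : A -> A -> Prop) (a b : option A) : Prop :=
  match a, b with
  | Some u, Some v => E u v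
  | None, None => True
  | _, _ => False
  end.

(* Walks do not change when their indices are shifted, at any depth. *)
Fixpoint same_walk w w' {struct w} : Prop :=
  match w, w' with
  | Walk0 x l, Walk0 x' l' =>
      exists k : int, forall m, x' m = x (m + k)%R /\ l' m = l (m + k)%R
  | WalkS r x l, WalkS r' x' l' =>
      r = r' /\ exists k : int, forall m,
        x' m = x (m + k)%R /\ opt_rel same_walk (l (m + k)%R) (l' m)
  | _, _ => False
  end.

Definition eventually_same w w' : Prop :=
  match w, w' with
  | Walk0 x l, Walk0 x' l' =>
      exists k N : int, forall m, (N <= m)%R ->
        x' m = x (m + k)%R /\ l' m = l (m + k)%R
  | WalkS r x l, WalkS r' x' l' =>
      r = r' /\ exists k N : int, forall m, (N <= m)%R ->
        x' m = x (m + k)%R /\ opt_rel same_walk (l (m + k)%R) (l' m)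
  | _, _ => False
  end.

(* The data of a wgraph of rank grank. The wtips are the sets of their
   representatives; a wnode x of rank mu (mu = 1, 2, ... or mu = omega) is the
   union of the set wtips x and of the at most one element of exc x; a wnode x
   of rank Arrow is the sequence arr x. *)
Record wgraph_data : Type := WGraphData {
  grank : rank;
  wnodes : set V;
  branches : set (set V);
  rk : V -> rank;
  wtips : V -> set (set (walk V));
  exc : V -> option V;
  arr : V -> nat -> V
}.

Variable G : wgraph_data.

(* A wnode of rank Arrow embraces whatever its elements embrace. *)
Inductive embraces : V -> V -> Prop :=
  | embraces_refl x : embraces x x
  | embraces_exc x z y : exc G x = Some z -> embraces z y -> embraces x y
  | embraces_arr x i y :
      rk G x = Arrow -> embraces (arr G x i) y -> embraces x y.

Definition embraces_wtip (x : V) (t : set (walk V)) : Prop :=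
  exists2 y, embraces x y & wtips G y t.

Definition indistinct (x y : V) : Prop := embraces x y \/ embraces y x.

Definition reaches_wtip_right w (x : V) : Prop :=
  ~ right_ended w /\
  exists2 t, embraces_wtip x t & exists2 w', t w' & eventually_same w' w.

Definition reaches_right w (x : V) : Prop :=
  (exists p v, right_end w p v /\ embraces x v) \/ reaches_wtip_right w x.

Definition reaches_wtip_left w (x : V) : Prop := reaches_wtip_right (wrev w) x.
Definition reaches_left w (x : V) : Prop := reaches_right (wrev w) x.

(* In a walk of rank Arrow the index c is that of the node from which the
   ranks increase: the start of a one-ended walk, or the junction of the two
   one-ended walks of which an endless walk consists. *)
Inductive is_walk : walk V -> Prop :=
  | is_walk_zero x l :
      alternating x l ->
      (forall m v, x m = Some v -> wnodes G v /\ rk G v = Fin 0) ->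
      (forall m b, l m = Some b -> branches G b /\
         exists u v, [/\ x m = Some u, x (m + 1)%R = Some v & b = [set u; v]]) ->
      is_walk (Walk0 x l)
  | is_walk_succ r s x l :
      rank_pred r = Some s ->
      rank_le r (grank G) ->
      alternating x l ->
      (forall m v, x m = Some v -> wnodes G v /\ rank_le (rk G v) r) ->
      (forall m w, l m = Some w -> is_walk w) ->
      (forall m w, l m = Some w -> rank_lt (wrank w) r /\
         exists u v, [/\ x m = Some u, x (m + 1)%R = Some v,
                         reaches_left w u & reaches_right w v]) ->
      (forall m v w w', x m = Some v -> l (m - 1)%R = Some w -> l m = Some w' ->
         rk G v = r /\
         ((wrank w = s /\ reaches_wtip_right w v) \/
          (wrank w' = s /\ reaches_wtip_left w' v))) ->
      is_walk (WalkS r x l)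
  | is_walk_arrow (c : int) x l :
      rank_le Arrow (grank G) ->
      alternating x l ->
      (forall m v, x m = Some v -> wnodes G v) ->
      (forall m w, l m = Some w -> is_walk w) ->
      (exists v, x c = Some v) ->
      (forall p v, left_end (WalkS Arrow x l) p v -> p = c) ->
      (forall p v, right_end (WalkS Arrow x l) p v -> p = c) ->
      (forall m w, (c <= m)%R -> l m = Some w ->
         exists u v (a b : nat),
           [/\ x m = Some u, x (m + 1)%R = Some v, rk G u = Fin a,
               rk G v = Fin b & (a < b)%N] /\
           [/\ wrank w = Fin b.-1, reaches_left w u & reaches_wtip_right w v]) ->
      (forall m w, (m < c)%R -> l m = Some w ->
         exists u v (a b : nat),
           [/\ x m = Some u, x (m + 1)%R = Some v, rk G u = Fin a,
               rk G v = Fin b & (b < a)%N] /\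
           [/\ wrank w = Fin a.-1, reaches_wtip_left w u & reaches_right w v]) ->
      is_walk (WalkS Arrow x l).

(* Representatives are directed towards their infinite end. *)
Definition is_wtip (r : rank) (t : set (walk V)) : Prop :=
  exists w, [/\ is_walk w, wrank w = r & one_ended_right w] /\
    t = [set w' | [/\ is_walk w', wrank w' = r, one_ended_right w'
                    & eventually_same w w']].

Definition wgraph : Prop :=
  [/\ forall x, wnodes G x -> rank_le (rk G x) (grank G),
      forall r, rank_le r (grank G) -> r <> Arrow ->
        exists2 x, wnodes G x & rk G x = r
    & forall b, branches G b -> exists u v,
        [/\ wnodes G u /\ rk G u = Fin 0, wnodes G v /\ rk G v = Fin 0,
            u <> v & b = [set u; v]]] /\
  [/\ forall x, wnodes G x -> rank_pred (rk G x) = None ->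
        wtips G x = set0 /\ exc G x = None,
      forall x s, wnodes G x -> rank_pred (rk G x) = Some s ->
        wtips G x !=set0 /\ (forall t, wtips G x t -> is_wtip s t),
      forall r s t, rank_le r (grank G) -> rank_pred r = Some s ->
        is_wtip s t -> exists x, [/\ wnodes G x, rk G x = r & wtips G x t]
    & forall x y t, wnodes G x -> wnodes G y ->
        wtips G x t -> wtips G y t -> x = y] /\
  [/\ forall x y, wnodes G x -> exc G x = Some y ->
        wnodes G y /\ rank_lt (rk G y) (rk G x)
    & forall x x' y, wnodes G x -> wnodes G x' ->
        exc G x = Some y -> exc G x' = Some y -> x = x'] /\
  [/\ forall x i, wnodes G x -> rk G x = Arrow ->
        [/\ wnodes G (arr G x i),
            exists a b : nat, [/\ rk G (arr G x i) = Fin a,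
                                  rk G (arr G x i.+1) = Fin b & (a < b)%N]
          & embraces (arr G x i.+1) (arr G x i)]
    & forall x y, wnodes G x -> wnodes G y -> rk G x = Arrow ->
        rk G y = Arrow -> arr G x =1 arr G y -> x = y].

(* omega ^ (infinite_expo r) is the length of a one-ended walk of rank r. *)
Definition infinite_expo (r : rank) : expo :=
  match r with
  | Fin n => (0, n.+1)%N
  | Arrow => (1, 0)%N
  | Omega => (1, 1)%N
  end.

Inductive wlength : walk V -> cnf -> Prop :=
  | wlength_one w : one_ended_right w \/ one_ended_left w ->
      wlength w (omega_pow (infinite_expo (wrank w)) 1)
  | wlength_endless w : endless w ->
      wlength w (omega_pow (infinite_expo (wrank w)) 2)
  | wlength_zero x l (p : int) (n : nat) u v :
      left_end (Walk0 x l) p u -> right_end (Walk0 x l) (p + n%:Z)%R v ->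
      wlength (Walk0 x l) (cnf_nat n)
  | wlength_sum r x l (p : int) (n : nat) u v (len : nat -> cnf) :
      left_end (WalkS r x l) p u -> right_end (WalkS r x l) (p + n%:Z)%R v ->
      (forall (i : nat) w, (i < n)%N -> l (p + i%:Z)%R = Some w ->
         wlength w (len i)) ->
      wlength (WalkS r x l) (\big[cnf_add/cnf_nat 0]_(i < n) len i).

(* Since wnodes embraced one by the other are not distinguished, w may
   terminate at wnodes that are only indistinct from x and y. *)
Definition joins w (x y : V) : Prop :=
  is_walk w /\ exists p q u v,
    [/\ left_end w p u, right_end w q v, indistinct u x & indistinct v y].

Definition wconnected : Prop :=
  forall x y, wnodes G x -> wnodes G y ->
    indistinct x y \/ exists w, joins w x y.

Definition wlengths (x y : V) : set cnf :=
  [set a | (indistinct x y /\ a = cnf_nat 0) \/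
           exists2 w, joins w x y & wlength w a].

Definition is_wdistance (x y : V) (d : cnf) : Prop :=
  wlengths x y d /\ forall a, wlengths x y a -> cnf_le d a.

Definition wdistance_le (x y : V) (a : cnf) : Prop :=
  exists2 d, is_wdistance x y d & cnf_le d a.

(* A wnode of rank Arrow has no wtips of its own; as a limit of wnodes, it is
   in the wsubgraph when infinitely many of its elements are. *)
Definition induced_wnodes (Bs : set (set V)) : set V :=
  let own x :=
    (rk G x = Fin 0 /\ exists2 b, Bs b & b x) \/
    exists t w, [/\ embraces_wtip x t, t w,
                    rank_pred (rk G x) = Some (wrank w) & wbranches w `<=` Bs] in
  [set x | wnodes G x /\
     (own x \/
      (rk G x = Arrow /\ forall n, exists2 i, (n <= i)%N & own (arr G x i)))].

(* The wsubgraph of {X^0, B, ..., X^r} induced by Bs, as a wgraph of rank r by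
   itself: its wnodes are wnodes of G, and keep the elements and the relation
   of embracing that they have in G; its walks are those of G of rank at
   most r all of whose wnodes and branches are in the wsubgraph. *)
Definition wsubgraph (r : rank) (Bs : set (set V)) : wgraph_data :=
  {| grank := r;
     wnodes := [set x | induced_wnodes Bs x /\ rank_le (rk G x) r];
     branches := Bs;
     rk := rk G;
     wtips := wtips G;
     exc := exc G;
     arr := arr G |}.

End Walks.

(* Walks of a wgraph_data of rank r have rank at most r, so that wconnected
   says that the wsubgraph is r-wconnected. *)
Definition wsection V (G : wgraph_data V) (r : rank) (S : wgraph_data V) :=
  exists Bs, [/\ S = wsubgraph G r Bs, Bs `<=` branches G, wconnected S
    & forall Bs', Bs `<=` Bs' -> Bs' `<=` branches G ->
        wconnected (wsubgraph G r Bs') -> Bs' = Bs].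

Definition free_ultrafilter (F : set_system nat) : Prop :=
  UltraFilter F /\ \bigcap_(A in F) A = set0.

Section Enlargement.
Variables (F : set_system nat) (V : Type).
Implicit Types (S : wgraph_data V).

(* Classes are taken among all sequences in T, so that the hypernodes of the
   enlargement of a wsubgraph are hypernodes of the enlargement of the wgraph. *)
Definition hclass T (xs : nat -> T) : set (nat -> T) :=
  [set ys | F [set n | xs n = ys n]].

Record hgraph : Type := HGraph {
  hypernodes : set (set (nat -> V));
  hyperbranches : set (set (nat -> set V))
}.

Definition wnode_seq S (g : rank) (xs : nat -> V) : Prop :=
  forall n, wnodes S (xs n) /\ rk S (xs n) = g.

Definition enlargement S : hgraph :=
  {| hypernodes := [set h | exists g xs, wnode_seq S g xs /\ h = hclass xs];
     hyperbranches := [set b | exists bs : nat -> set V,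
       (forall n, branches S (bs n)) /\ b = hclass bs] |}.

Definition incident S (b : set (nat -> set V)) (h : set (nat -> V)) : Prop :=
  exists us vs, [/\ wnode_seq S (Fin 0) us, wnode_seq S (Fin 0) vs,
    b = hclass (fun n => [set us n; vs n]) & h = hclass us].

Definition standard S (h : set (nat -> V)) : Prop :=
  exists2 v, wnodes S v & h = hclass (fun _ => v).

Definition limited_seq (r : rank) S (xs ys : nat -> V) : Prop :=
  match r with
  | Fin k => exists m : nat,
      F [set n | wdistance_le S (xs n) (ys n) (omega_pow (0, k)%N m)]
  | Omega => exists m : nat,
      F [set n | wdistance_le S (xs n) (ys n) (omega_pow (1, 0)%N m)]
  | Arrow => exists m : nat,
      F [set n | wdistance_le S (xs n) (ys n) (omega_pow (0, m)%N 1)]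
  end.

Definition limitedly_distant (r : rank) S (h k : set (nat -> V)) : Prop :=
  exists xs ys, [/\ h = hclass xs, k = hclass ys & limited_seq r S xs ys].

Definition galaxy S (N : set (set (nat -> V))) : hgraph :=
  {| hypernodes := N;
     hyperbranches := [set b | hyperbranches (enlargement S) b /\
       forall h, incident S b h -> N h] |}.

Definition principal_galaxy (r : rank) S : hgraph :=
  galaxy S [set h | hypernodes (enlargement S) h /\
    exists k, standard S k /\ limitedly_distant r S h k].

End Enlargement.

(* Main.v *)
Require Import Defs.
From mathcomp Require Import all_boot all_order all_algebra zify.
From mathcomp Require Import boolp classical_sets filter.
Local Open Scope classical_set_scope.

(** The nodes of an alpha-wsection lie at uniformly bounded distance from each
other: any two of them that are not already identified are joined by a
two-ended walk of some rank r <= alpha, and such a walk has length below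
omega ^ e, where omega ^ e is the length of a one-ended walk of rank r
([two_ended_walk_length]). Indeed the walk is a finite chain of walks of lower
rank, each of them of length at most omega ^ e' times 2 for some e' < e when it
is infinite, and of length below such an omega ^ e' by induction when it is
two-ended; a natural sum of ordinals merges their exponents, so that finitely
many ordinals with exponents below e have a sum with exponents below e.

Since a walk of the alpha-wsection is also a walk of the rho-wsection that
contains it ([wsubgraph_is_walk]), the same bound omega ^ e, now with e the
exponent attached to alpha, holds for the wdistances of the rho-wsection. These
wdistances exist because the ordinals in question are well ordered
([cnf_has_min]). As alpha < rho, the bound makes any two sequences of wnodes of
the alpha-wsection rho-limitedly distant ([limited_wsubgraph]): omega ^ e is at
most omega ^ rho when rho is natural, at most omega ^ omega when rho = omega,
and when rho is the special rank alpha is a natural number n and e = n + 1 is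
an admissible exponent. Comparing a hypernode with the constant sequence at one
of its own entries puts it into the principal galaxy.

A 0-hypernode incident to a hyperbranch of the smaller enlargement has a
representative lying in the alpha-wsection, since almost all of its entries
belong to branches of that wsection; hence hyperbranches follow from
hypernodes. *)

Set Implicit Arguments.
Unset Strict Implicit.
Unset Printing Implicit Defensive.
Import Order.TTheory GRing.Theory Num.Theory.

(** * The ordinals below omega ^ (omega ^ 2) are well ordered *)

Lemma nat_has_min (A : set nat) :
  A !=set0 -> exists2 m, A m & forall n, A n -> (m <= n)%N.
Proof.
case=> a Aa; have exA : exists n, `[< A n >] by exists a; apply/asboolP.
case: (ex_minnP exA) => m /asboolP Am minm.
by exists m => // n An; apply: minm; apply/asboolP.
Qed.

Lemma expo_has_min (A : set expo) :
  A !=set0 -> exists2 e, A e & forall e', A e' -> (e <= e')%O.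
Proof.
case=> -[a b] Aab.
have [|m [c Amc] minm] := @nat_has_min [set a | exists b, A (a, b)].
  by exists a, b.
have [|n Amn minn] := @nat_has_min [set b | A (m, b)]; first by exists c.
exists (m, n) => // -[a' b'] Aa'b'; rewrite lexi_pair !leEnat.
rewrite (minm a'); last by exists b'.
apply/implyP => le_a'm; apply: minn; suff <- : a' = m by [].
by apply/eqP; rewrite eqn_leq le_a'm minm //; exists b'.
Qed.

Lemma expo_ind (P : expo -> Prop) :
  (forall e, (forall e', (e' < e)%O -> P e') -> P e) -> forall e, P e.
Proof.
move=> indP e; apply: contrapT => nPe.
have [|m nPm minm] := @expo_has_min [set e | ~ P e]; first by exists e.
apply: nPm; apply: indP => e' lt_e'm; apply: contrapT => /minm.
by rewrite leNgt lt_e'm.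
Qed.

(** The order of [cnf] on bare sequences, so that sequences can be decomposed
without carrying proofs of sortedness. *)
Definition expos_le (s t : seq expo) : bool := ((s : seqlexi expo) <= t)%O.

Lemma expos_le_cat (u s t : seq expo) :
  expos_le (u ++ s) (u ++ t) = expos_le s t.
Proof. by elim: u => //= e u IH; rewrite /expos_le lexi_cons lexx. Qed.

Lemma expos_le_all (e : expo) (s t : seq expo) :
  all (fun e' => (e' < e)%O) s -> expos_le s (e :: t).
Proof.
case: s => [_|h s /= /andP[lt_he _]]; first exact: lexi0s.
by rewrite /expos_le lexi_cons (ltW lt_he) leNgt lt_he.
Qed.

(** Writes an ordinal below omega ^ (e + 1) as omega ^ e * k + t, with
t < omega ^ e. *)
Lemma split_leading (e : expo) (s : seq expo) :
  sorted (>=%O : rel expo) s -> all (fun e' => (e' <= e)%O) s ->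
  exists k t, s = nseq k e ++ t /\ all (fun e' => (e' < e)%O) t.
Proof.
elim: s => [|h s IH] /=; first by exists 0, [::].
move=> sorted_s /andP[le_he all_s].
have [h_e|ne_he] := eqVneq h e.
  have [k [t [-> all_t]]] := IH (path_sorted sorted_s) all_s.
  by exists k.+1, t; rewrite h_e.
have lt_he : (h < e)%O by rewrite lt_neqAle ne_he.
exists 0, (h :: s); split=> //=; rewrite lt_he /=.
have /allP le_sh := order_path_min (@ge_trans _ expo) sorted_s.
by apply/allP => e' /le_sh le_e'h; apply: le_lt_trans lt_he.
Qed.

(** Well-founded induction on the bound e for the exponents. Writing the members
of A as omega ^ e * k + t with t < omega ^ e, the least ordinal has the least
possible k, and then the least possible t. If t = 0 does not occur, its leading
exponent h < e is minimised in turn, and the induction hypothesis for h deals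
with what follows. *)
Lemma expos_has_min (e : expo) (A : set (seq expo)) :
  A !=set0 ->
  (forall s, A s -> sorted (>=%O : rel expo) s) ->
  (forall s, A s -> all (fun e' => (e' <= e)%O) s) ->
  exists2 m, A m & forall s, A s -> expos_le m s.
Proof.
elim/expo_ind: e A => e IH A [s0 As0] sortedA boundA.
pose below t := all (fun e' => (e' < e)%O) t.
have [|k [t0 Akt0 below_t0] min_k] :=
  @nat_has_min [set k | exists2 t, A (nseq k e ++ t) & below t].
  have [k [t [s0E below_t]]] := split_leading (sortedA _ As0) (boundA _ As0).
  by exists k, t; rewrite -?s0E.
pose B : set (seq expo) := [set t | A (nseq k e ++ t) /\ below t].
have sortedB t : B t -> sorted (>=%O : rel expo) t.
  case=> /sortedA.
  rewrite -[X in nseq X _](size_nseq k e) => /(@drop_sorted _ _ k).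
  by rewrite size_nseq drop_size_cat ?size_nseq.
(* A larger multiple of omega ^ e exceeds anything of the form
   omega ^ e * k + t with t < omega ^ e, so only B has to be considered. *)
suff [m [Am below_m] min_m] : exists2 m, B m & forall t, B t -> expos_le m t.
  exists (nseq k e ++ m) => // s As.
  have [k' [t [sE below_t]]] := split_leading (sortedA _ As) (boundA _ As).
  have : (k <= k')%N by apply: min_k; exists t; rewrite -?sE.
  rewrite leq_eqVlt => /orP[/eqP k_k'|lt_kk'].
    by rewrite sE -k_k' expos_le_cat; apply: min_m; split; rewrite // k_k' -sE.
  rewrite sE -(subnKC lt_kk') addSnnS nseqD -catA expos_le_cat /=.
  exact: expos_le_all.
have [B0|nB0] := pselect (B [::]).
  by exists [::] => // t _; exact: lexi0s.
have [|h [t1 Bht1] min_h] := @expo_has_min [set h | exists t, B (h :: t)].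
  case: t0 Akt0 below_t0 => [|h t] Akt below_t; first by case: nB0.
  by exists h, t.
have lt_he : (h < e)%O by case: Bht1 => _ /andP[].
have [|||m Bhm min_m] := IH h lt_he [set t | B (h :: t)].
- by exists t1.
- by move=> t /sortedB; apply: path_sorted.
- by move=> t /sortedB/(order_path_min (@ge_trans _ expo)).
exists (h :: m) => // -[|h' t] Bt; first by case: nB0.
rewrite /expos_le lexi_cons min_h /=; last by exists t.
apply/implyP => le_h'h; apply: min_m; suff <- : h' = h by [].
by apply/eqP; rewrite eq_le le_h'h min_h //; exists t.
Qed.

Lemma cnf_le_trans (b a c : cnf) : cnf_le a b -> cnf_le b c -> cnf_le a c.
Proof. exact: le_trans. Qed.

(** Only the members of A below a fixed one matter, and the leading exponent of
that one bounds all their exponents. *)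
Lemma cnf_has_min (A : set cnf) :
  A !=set0 -> exists2 m, A m & forall a, A a -> cnf_le m a.
Proof.
case=> a0 Aa0; case a0E : (cnf_seq a0) => [|e s0].
  by exists a0 => // a _; rewrite /cnf_le a0E; exact: lexi0s.
pose B := [set cnf_seq a | a in [set a | A a /\ cnf_le a a0]].
have [|||_ [m [Am le_ma0] <-] min_m] := @expos_has_min e B.
- by exists (cnf_seq a0), a0 => //; split=> //; exact: lexx.
- by move=> _ [a _ <-]; exact: cnf_sorted.
- move=> _ [a [_ le_aa0] <-]; move: le_aa0 (cnf_sorted a); rewrite /cnf_le a0E.
  case: (cnf_seq a) => //= h t; rewrite lexi_cons => /andP[le_he _].
  move=> /(order_path_min (@ge_trans _ expo)) /allP le_th.
  by rewrite le_he; apply/allP => e' /le_th le_e'h; apply: le_trans le_he.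
exists m => // a Aa; have [le_aa0|] := boolP (cnf_le a a0).
  by apply: min_m; exists a.
rewrite /cnf_le -ltNge => /ltW le_a0a; exact: cnf_le_trans le_a0a.
Qed.

(** * Lengths of walks *)

Lemma rank_le_trans (s r t : rank) : rank_le r s -> rank_le s t -> rank_le r t.
Proof.
by case: r => [a||]; case: s => [b||]; case: t => [c||] //=; exact: leq_trans.
Qed.

Lemma infinite_expo_le (r s : rank) :
  rank_le r s -> (infinite_expo r <= infinite_expo s)%O.
Proof.
by case: r => [a||]; case: s => [b||] //= le_rs; rewrite lexi_pair !leEnat.
Qed.

Lemma infinite_expo_lt (r s : rank) :
  rank_lt r s -> (infinite_expo r < infinite_expo s)%O.
Proof.
rewrite /rank_lt; case: r => [a||]; case: s => [b||] //= /andP[_ nle_sr];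
  rewrite ltxi_pair !leEnat ?ltEnat //=.
by rewrite ltnS ltnNge.
Qed.

Section WalkLengths.
Variable V : Type.
Implicit Types (w : walk V) (x : int -> option V).

(** The left end of a walk precedes its right end because the link after the
left end and the one before the right end are present, while the link at the
right end is absent: links occupy an interval of indices. *)
Lemma alternating_ends L x (l : int -> option L) (p q : int) :
  alternating x l -> x p <> None -> x (p - 1)%R = None ->
  x q <> None -> x (q + 1)%R = None -> (p < q)%R.
Proof.
case=> _ convex_l x_l xp xp1 xq xq1.
have lp1 : l (p - 1)%R = None.
  by apply: contrapT => lp1; case: (x_l (p - 1)%R).2 => //; right.
have lp : l p <> None by case: (x_l p).1.
have lq : l q = None.
  by apply: contrapT => lq; case: (x_l (q + 1)%R).2; rewrite ?addrK //; left.
have lq1 : l (q - 1)%R <> None by case: (x_l q).1.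
rewrite ltNge; apply/negP => le_qp.
by case: (convex_l (q - 1)%R q p) => //; rewrite le_qp lerBlDr lerDl.
Qed.

Lemma left_end_Some w p v : left_end w p v -> wnode_at w p <> None.
Proof. by case=> ->. Qed.

Lemma right_end_Some w p v : right_end w p v -> wnode_at w p <> None.
Proof. by case=> ->. Qed.

(** Encodes a < omega ^ e in a form that natural sums visibly preserve. *)
Definition expos_below (e : expo) (a : cnf) : bool :=
  all (fun e' => (e' < e)%O) (cnf_seq a).

Lemma expos_below_sum (e : expo) (n : nat) (len : nat -> cnf) :
  (forall i, (i < n)%N -> expos_below e (len i)) ->
  expos_below e (\big[cnf_add/cnf_nat 0]_(i < n) len i).
Proof.
move=> below_len; elim/big_rec: _ => // i a _ below_a.
by rewrite /expos_below all_merge [X in X && _]below_len.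
Qed.

Lemma expos_below_le (e : expo) (a : cnf) :
  expos_below e a -> cnf_le a (omega_pow e 1).
Proof. exact: expos_le_all. Qed.

Lemma infinite_walk_length w : ~ two_ended w ->
  exists k, wlength w (omega_pow (infinite_expo (wrank w)) k).
Proof.
move=> n2; have [L|nL] := pselect (left_ended w);
  have [R|nR] := pselect (right_ended w).
- by case: n2.
- by exists 1%N; apply: wlength_one; left.
- by exists 1%N; apply: wlength_one; right.
- by exists 2; apply: wlength_endless.
Qed.

(** Both ends would have to be the node from which the ranks increase, whereas a
walk has at least one link. *)
Lemma two_ended_not_arrow (S : wgraph_data V) w :
  is_walk S w -> two_ended w -> wrank w <> Arrow.
Proof.
case=> // [r s x l + _ _ _ _ _ _ _ /= rE|]; first by rewrite rE.
move=> c x l _ alt_l _ _ _ left_c right_c _ _ [[p [u Lp]] [q [v Rq]]] _.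
have pc := left_c _ _ Lp; have qc := right_c _ _ Rq.
have := alternating_ends alt_l (left_end_Some Lp) Lp.2
  (right_end_Some Rq) Rq.2.
by rewrite pc qc ltxx.
Qed.

(** A link of a walk of rank r has rank r' < r. If it is two-ended the induction
applies to it, and otherwise its length is a finite multiple of
omega ^ infinite_expo r'; in both cases its exponents are below
infinite_expo r, and so are those of the finite natural sum. *)
Lemma two_ended_walk_length (S : wgraph_data V) w :
  is_walk S w -> two_ended w ->
  exists2 a, wlength w a & expos_below (infinite_expo (wrank w)) a.
Proof.
elim=> {w} [x l alt_l _ _ [[p [u Lp]] [q [v Rq]]]
  |r s x l _ _ alt_l _ _ IH lt_l _|].
- have ltpq := alternating_ends alt_l (left_end_Some Lp) Lp.2
    (right_end_Some Rq) Rq.2.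
  have qE : q = (p + `|q - p|%N%:Z)%R by lia.
  exists (cnf_nat `|q - p|); last by apply/allP => e /nseqP[-> _].
  by apply: (wlength_zero Lp); rewrite -qE; exact: Rq.
- case=> -[p [u Lp]] [q [v Rq]].
  have ltpq := alternating_ends alt_l (left_end_Some Lp) Lp.2
    (right_end_Some Rq) Rq.2.
  have qE : q = (p + `|q - p|%N%:Z)%R by lia.
  have link_length (i : nat) : exists a, expos_below (infinite_expo r) a /\
      forall w, l (p + i%:Z)%R = Some w -> wlength w a.
    case li : (l _) => [w|]; last by exists (cnf_nat 0).
    have lt_wr : (infinite_expo (wrank w) < infinite_expo r)%O.
      by apply: infinite_expo_lt; case: (lt_l _ _ li).
    have [ends2|ends_inf] := pselect (two_ended w).
      have [a len_a below_a] := IH _ _ li ends2.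
      exists a; split=> [|_ [<-] //].
      by apply/allP => e /(allP below_a) lt_ew; apply: lt_trans lt_wr.
    have [k len_k] := infinite_walk_length ends_inf.
    exists (omega_pow (infinite_expo (wrank w)) k); split=> [|_ [<-] //].
    by apply/allP => e /nseqP[-> _].
  have [len lenP] := choice link_length.
  exists (\big[cnf_add/cnf_nat 0]_(i < `|q - p|) len i).
    apply: (wlength_sum Lp); first by rewrite -qE; exact: Rq.
    by move=> i w _ li; apply: (lenP i).2.
  by apply: expos_below_sum => i _; case: (lenP i).
- move=> c x l le_S alt_l nodes_l walks_l _ xc left_c right_c inc dec ends2.
  by have /(_ ends2) := two_ended_not_arrow (is_walk_arrow le_S alt_l nodes_l
    walks_l xc left_c right_c inc dec).
Qed.

Lemma walk_rank_le (S : wgraph_data V) w :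
  is_walk S w -> rank_le (wrank w) (grank S).
Proof. by case=> //= x l _ _ _; case: (grank S). Qed.

Lemma wconnected_bounded (S : wgraph_data V) (x y : V) :
  wconnected S -> wnodes S x -> wnodes S y ->
  exists2 a, wlengths S x y a & cnf_le a (omega_pow (infinite_expo (grank S)) 1).
Proof.
move=> connS Sx Sy; have [ind_xy|[w join_w]] := connS x y Sx Sy.
  by exists (cnf_nat 0); [left | exact: expos_below_le].
have [walk_w [p [q [u [v [Lp Rq _ _]]]]]] := join_w.
have [|a len_a below_a] := two_ended_walk_length walk_w.
  by split; [exists p, u | exists q, v].
exists a; first by right; exists w.
apply: expos_below_le; apply/allP => e /(allP below_a) lt_ew.
by apply: (lt_le_trans lt_ew); apply/infinite_expo_le/walk_rank_le.
Qed.

Lemma wdistance_leP (S : wgraph_data V) (x y : V) (a b : cnf) :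
  wlengths S x y a -> cnf_le a b -> wdistance_le S x y b.
Proof.
move=> xy_a le_ab; have [|d xy_d min_d] := @cnf_has_min (wlengths S x y).
  by exists a.
by exists d; [split | apply: cnf_le_trans le_ab; apply: min_d].
Qed.

End WalkLengths.

(** * Walks and distances in nested wsubgraphs *)

Section Wsubgraphs.
Variables (V : Type) (G : wgraph_data V).

(** Embracing depends only on the exceptional elements and on the sequences that
are the wnodes of the special rank, which wsubgraphs keep from G. *)
Lemma embraces_wsubgraph (r : rank) (Bs : set (set V)) :
  embraces (wsubgraph G r Bs) = embraces G.
Proof.
apply/funext => x; apply/funext => y; apply/propext; split.
  elim=> {x y} [x|x z y excx _ IH|x i y rkx _ IH]; first exact: embraces_refl.
    exact: (embraces_exc (G := G) excx IH).
  exact: (embraces_arr (G := G) rkx IH).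
elim=> {x y} [x|x z y excx _ IH|x i y rkx _ IH]; first exact: embraces_refl.
  exact: (embraces_exc (G := wsubgraph G r Bs) excx IH).
exact: (embraces_arr (G := wsubgraph G r Bs) rkx IH).
Qed.

Variables (r r' : rank) (Bs Bs' : set (set V)).
Hypotheses (le_r : rank_le r r') (sub_B : Bs `<=` Bs').
Local Notation S := (wsubgraph G r Bs).
Local Notation S' := (wsubgraph G r' Bs').

Lemma wsubgraph_wnodes : wnodes S `<=` wnodes S'.
Proof.
have own_sub x : forall (t : set (walk V)) w,
    [/\ embraces_wtip G x t, t w, rank_pred (rk G x) = Some (wrank w)
      & wbranches w `<=` Bs] ->
    [/\ embraces_wtip G x t, t w, rank_pred (rk G x) = Some (wrank w)
      & wbranches w `<=` Bs'].
  by move=> t w [? ? ? sub_w]; split=> //; apply: subset_trans sub_B.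
move=> x [[Gx own_x] le_x]; split; last exact: rank_le_trans le_r.
split=> //; case: own_x => [[[rk0 [b Bb bx]]|[t [w /own_sub w_t]]]|[rkA own_arr]].
- by left; left; split=> //; exists b => //; apply: sub_B.
- by left; right; exists t, w.
- right; split=> // n; have [i le_ni own_i] := own_arr n; exists i => //.
  case: own_i => [[rk0 [b Bb bx]]|[t [w /own_sub w_t]]].
    by left; split=> //; exists b => //; apply: sub_B.
  by right; exists t, w.
Qed.

Lemma reaches_wtip_right_wsubgraph :
  reaches_wtip_right S = reaches_wtip_right S'.
Proof. by rewrite /reaches_wtip_right /embraces_wtip !embraces_wsubgraph. Qed.

Lemma reaches_right_wsubgraph : reaches_right S = reaches_right S'.
Proof.
by rewrite /reaches_right reaches_wtip_right_wsubgraph !embraces_wsubgraph.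
Qed.

(** Walks of a wsubgraph are constrained only by which wnodes, branches and
ranks are available, and by the wnodes reached, which is decided in G. *)
Lemma wsubgraph_is_walk w : is_walk S w -> is_walk S' w.
Proof.
elim=> {w} [x l alt_l nodes_x links_l
  |k s x l kE le_k alt_l nodes_x _ IH links_l joint_x
  |c x l le_k alt_l nodes_x _ IH xc left_c right_c inc dec].
- apply: is_walk_zero => // [m v /nodes_x[Sv rkv]|m b /links_l[Bb uv]].
    by split=> //; apply: wsubgraph_wnodes.
  by split=> //; apply: sub_B.
- apply: is_walk_succ kE _ alt_l _ IH _ _; first exact: rank_le_trans le_r.
  + by move=> m v /nodes_x[Sv rkv]; split=> //; apply: wsubgraph_wnodes.
  + by rewrite /reaches_left -reaches_right_wsubgraph.
  + by rewrite /reaches_wtip_left -reaches_wtip_right_wsubgraph.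
- apply: is_walk_arrow alt_l _ IH xc left_c right_c _ _.
  + exact: rank_le_trans le_r.
  + by move=> m v /nodes_x/wsubgraph_wnodes.
  + by rewrite /reaches_left -reaches_right_wsubgraph
      -reaches_wtip_right_wsubgraph.
  + by rewrite /reaches_wtip_left -reaches_right_wsubgraph
      -reaches_wtip_right_wsubgraph.
Qed.

Lemma wsubgraph_wlengths x y : wlengths S x y `<=` wlengths S' x y.
Proof.
have indE : indistinct S = indistinct S'.
  by rewrite /indistinct !embraces_wsubgraph.
move=> a [[ind_xy ->]|[w [walk_w ends_w] len_a]]; [left | right].
  by rewrite -indE.
by exists w => //; split; [exact: wsubgraph_is_walk | rewrite -indE].
Qed.

Hypothesis conn_S : wconnected S.

Lemma wsubgraph_wdistance_le x y : wnodes S x -> wnodes S y ->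
  wdistance_le S' x y (omega_pow (infinite_expo r) 1).
Proof.
move=> Sx Sy.
have [a /wsubgraph_wlengths xy_a le_a] := wconnected_bounded conn_S Sx Sy.
exact: wdistance_leP le_a.
Qed.

Variable F : set_system nat.
Hypothesis F_filter : Filter F.

(** The bound omega ^ infinite_expo r does not depend on the index n, so that it
holds on the whole of nat, and r < r' makes it one that r' allows. *)
Lemma limited_wsubgraph (xs ys : nat -> V) : rank_lt r r' ->
  (forall n, wnodes S (xs n)) -> (forall n, wnodes S (ys n)) ->
  limited_seq F r' S' xs ys.
Proof.
move=> lt_r Sxs Sys.
have all_le e : (infinite_expo r <= e)%O ->
    F [set n | wdistance_le S' (xs n) (ys n) (omega_pow e 1)].
  move=> le_e; apply: filterE => n.
  have [d dist_d le_d] := wsubgraph_wdistance_le (Sxs n) (Sys n).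
  exists d => //; apply: cnf_le_trans le_d _.
  by rewrite /cnf_le /= lexi_cons le_e lexx implybT.
move: lt_r; rewrite /rank_lt /limited_seq; case: r' all_le => [k||] all_le.
- case: r all_le => //= j all_le /andP[_]; rewrite -ltnNge => lt_jk.
  by exists 1; apply: all_le; rewrite lexi_pair !leEnat lt_jk.
- by case: r all_le => //= j all_le _; exists j.+1; apply: all_le.
- move=> lt_r; exists 1; apply: all_le.
  by move: lt_r; case: r => //= j _; rewrite lexi_pair !leEnat.
Qed.

End Wsubgraphs.

(** * Enlargements *)

Lemma hclass_eq (F : set_system nat) (T : Type) (xs ys : nat -> T) :
  Filter F -> F [set n | xs n = ys n] -> hclass F xs = hclass F ys.
Proof.
move=> FF eq_xy; apply/seteqP; split=> zs; apply: filterS2 eq_xy => n /=.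
  by move=> ->.
by move=> <-.
Qed.

Theorem theorem3p2 (F : set_system nat) (V : Type) (nu alpha rho : rank)
    (G Sa Sr : wgraph_data V) :
  free_ultrafilter F ->
  wgraph G -> grank G = nu -> wconnected G ->
  rank_lt alpha rho -> rank_le rho nu ->
  wsection G alpha Sa -> wsection G rho Sr ->
  branches Sa `<=` branches Sr ->
  hypernodes (enlargement F Sa) `<=` hypernodes (principal_galaxy F rho Sr) /\
  hyperbranches (enlargement F Sa)
    `<=` hyperbranches (principal_galaxy F rho Sr).
Proof.
case=> uF _ _ _ _ lt_r _ [Ba [-> _ conn_a _]] [Br [-> _ _ _]] /= sub_B.
have pF : ProperFilter F by exact: ultra_proper.
have fF : Filter F by exact: filter_filter.
have le_r : rank_le alpha rho by case/andP: lt_r.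
have nodes_sub := wsubgraph_wnodes (G := G) le_r sub_B.
have hypernodes_sub : hypernodes (enlargement F (wsubgraph G alpha Ba)) `<=`
    hypernodes (principal_galaxy F rho (wsubgraph G rho Br)).
  move=> h [g [xs [Sxs hE]]]; split.
    exists g, xs; split=> // n; have [Sx rkx] := Sxs n.
    by split; [exact: nodes_sub | ].
  have Sx0 := (Sxs 0%N).1.
  exists (hclass F (fun=> xs 0%N)); split.
    by exists (xs 0%N) => //; exact: nodes_sub.
  exists xs, (fun=> xs 0%N); split=> //.
  by apply: (limited_wsubgraph le_r sub_B) => // n; case: (Sxs n).
split=> // b [bs [Bbs bE]]; split.
  by exists bs; split=> // n; apply: sub_B.
move=> h [us [vs [Sus _ bE' hE]]]; apply: hypernodes_sub.
have F_eq : F [set n | [set us n; vs n] = bs n].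
  have : hclass F bs bs by apply: filterE.
  by rewrite -bE bE'.
have Sa_us n : [set us n; vs n] = bs n -> wnodes (wsubgraph G alpha Ba) (us n).
  move=> bnE; have [[[Gu _] _] rku] := Sus n; split;
    last by rewrite rku; case: (alpha).
  split=> //; left; left; split=> //; exists (bs n); first exact: Bbs.
  by rewrite -bnE; left.
(* A hypernode needs a representative all of whose entries are in the smaller
   wsubgraph: the entries us n outside of it are replaced by the fixed us n0. *)
have [n0 eq_n0] := filter_ex F_eq.
pose us' n := if `[< [set us n; vs n] = bs n >] then us n else us n0.
exists (Fin 0), us'; split.
  move=> n; rewrite /us'; case: asboolP => [eq_n|_].
    by split; [exact: Sa_us | case: (Sus n)].
  by split; [exact: Sa_us | case: (Sus n0)].
rewrite hE; apply: hclass_eq; apply: filterS F_eq => n eq_n /=.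
by rewrite /us'; case: asboolP.
Qed.
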